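(* Let $D\ge 35$ be an integer and let $e$ be an edge of the Kautz digraph $K(2,D)$ whose edge-word $w(e)$ is an unbordered $7/4^{+}$-power-free ternary word of length $D+1$. Then $\mathrm{cong}(e)>\tau(2,D)$, where $\tau(2,D)=(D-1)2^{D-2}+D\,2^{D-1}$.
   Context: The Kautz digraph $K(2,D)$ has as vertices all words $x_0\cdots x_{D-1}$ of length $D$ over $\{0,1,2\}$ with $x_i\ne x_{i+1}$ for all $i$, and directed edges $x_0x_1\cdots x_{D-1}\to x_1\cdots x_{D-1}x_D$ for $x_D\in\{0,1,2\}\setminus\{x_{D-1}\}$. Every ordered pair of distinct vertices is joined by a unique shortest directed path (geodesic). An edge $e:u\to v$ with $u=a_0\cdots a_{D-1}$, $v=a_1\cdots a_D$ has edge-word $w(e)=a_0a_1\cdots a_D$. For an edge $e$, $\mathrm{cong}(e)$ is the number of ordered pairs $(x,y)$ of distinct vertices whose unique geodesic from $x$ to $y$ uses $e$. A word $a_0\cdots a_D$ is unbordered if there is no $\ell$ with $1\le\ell\le D$ such that $a_0\cdots a_{\ell-1}=a_{D-\ell+1}\cdots a_D$. A word is $7/4^{+}$-free (also called $7/4^{+}$-power-free) if it contains no contiguous subword $x^ky$, with $x$ nonempty, $k\ge1$ an integer and $y$ a possibly empty prefix of $x$, such that $|x^ky|/|x|>7/4$. *)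

(* Defs.v *)
From HB Require Import structures.
From mathcomp Require Import all_boot all_order all_algebra.
From mathcomp Require Import boolp.

Set Implicit Arguments.
Unset Strict Implicit.
Unset Printing Implicit Defensive.

Definition unbordered (T : eqType) (w : seq T) : Prop :=
  forall l : nat, 1 <= l -> l < size w -> take l w <> drop (size w - l) w.

(* [plus_power_free r w]: w is r^+-power-free. *)
Definition plus_power_free (T : eqType) (r : rat) (w : seq T) : Prop :=
  ~ exists (x y : seq T) (k : nat),
      let z := flatten (nseq k x) ++ y in
      [/\ x <> [::], 1 <= k, prefix y x, infix z w
        & (r < (size z)%:R / (size x)%:R :> rat)%R].

Section Congestion.
Variables (T : finType) (E : rel T).

(* As in path.v, the walk x :: p is given by its start x and its tail p. *)
Definition geodesic (x y : T) (p : seq T) : Prop :=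
  [/\ path E x p, last x p = y
    & forall q : seq T, path E x q -> last x q = y -> size p <= size q].

Definition uses_edge (u v x : T) (p : seq T) : bool :=
  (u, v) \in zip (x :: p) p.

(* "A geodesic uses (u, v)" is "the geodesic uses (u, v)" when geodesics are
   unique, as they are in the Kautz digraph. *)
Definition cong (u v : T) : nat :=
  #|[set xy : T * T | (xy.1 != xy.2) &&
      `[< exists2 p, geodesic xy.1 xy.2 p & uses_edge u v xy.1 p >]]|.
End Congestion.

Definition kautz_word (w : seq 'I_3) : bool := sorted (fun a b => a != b) w.

Record kautz (D : nat) := Kautz {
  kautz_tuple :> D.-tuple 'I_3;
  _ : kautz_word kautz_tuple }.

HB.instance Definition _ D := [isSub for @kautz_tuple D].
HB.instance Definition _ D := [Countable of kautz D by <:].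
HB.instance Definition _ D := [Finite of kautz D by <:].

(* [kautz_word (rcons u a)] says that the appended letter a differs from the
   last letter of u. *)
Definition kautz_edge (D : nat) : rel (kautz D) := fun u v =>
  [exists a : 'I_3,
     kautz_word (rcons u a) && (v == rcons (behead u) a :> seq 'I_3)].

(* The default of [last] is irrelevant for D >= 1. *)
Definition edge_word (D : nat) (u v : kautz D) : seq 'I_3 :=
  rcons u (last ord0 v).

(* tau(2, D); the natural subtractions are not truncated for D >= 2. *)
Definition tau2 (D : nat) : nat := (D - 1) * 2 ^ (D - 2) + D * 2 ^ (D - 1).

(* Main.v *)
Require Import Defs.
From mathcomp Require Import all_boot all_order all_algebra.
From mathcomp Require Import boolp zify.
Import GRing.Theory Num.Theory.

(** The walks of length t through the edge with word w that put i letters to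
    the left and j letters to the right of w, where t = i + j + 1, number
    2^(t-1); over all t <= D these are (D-1) 2^D + 1 walks. Such a walk fails
    to be a geodesic iff, for some s < t, the factor left after deleting s
    letters at both ends has period t - s; then the letters between w and the
    deleted ends are determined by w, so that at most 2^(min(i,s) + min(j,s))
    walks fail because of s. Comparing this period with w itself, unborderedness
    rules out s <= i, j, and 7/4^+-freeness forces 4 D + 3 s <= 3 + 3 i + 7 j
    and i < s, up to exchanging i and j. Summing the resulting geometric series
    leaves at most 8 * 2^D failing walks, which is at most (D-3) 2^(D-2) for
    D >= 35, and (D-1) 2^D + 1 - (D-3) 2^(D-2) = tau(2,D) + 1. *)

(** * Sums of powers of two *)

Lemma sum_exp2 (n : nat) : (\sum_(i < n) 2 ^ i).+1 = 2 ^ n.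
Proof. by rewrite -[RHS]prednK ?expn_gt0// predn_exp mul1n. Qed.

(** For fixed [i] the inner sum is [2 ^ D - 2 ^ i]. Adding [2 ^ D], which is 1 plus the sum of all
    [2 ^ i], cancels these losses without natural subtraction. *)
Lemma sum_exp2_triangle (D : nat) :
  \sum_(i < D) \sum_(j < D | i + j < D) 2 ^ (i + j) + 2 ^ D = D * 2 ^ D + 1.
Proof.
rewrite -{1}[2 ^ D]sum_exp2 addn1 addnS -big_split /=; congr _.+1.
rewrite (eq_bigr (fun=> 2 ^ D)) ?sum_nat_const ?card_ord// => i _.
have iD := ltn_ord i.
rewrite (eq_bigl (fun j : 'I_D => j < D - i)); last by move=> j; rewrite ltn_subRL.
rewrite -(big_ord_widen _ (fun j => 2 ^ (i + j))) ?leq_subr//.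
under eq_bigr => j _ do rewrite expnD.
rewrite -big_distrr/= -mulnSr sum_exp2 -expnD; congr (2 ^ _); lia.
Qed.

Lemma leq_sum_ord_cond (m n : nat) (P : pred nat) (F : nat -> nat) :
  (forall i, P i -> i < n) -> \sum_(i < m | P i) F i <= \sum_(i < n) F i.
Proof.
move=> Pn; rewrite (big_ord_widen (maxn m n)) ?leq_maxr//.
rewrite (big_ord_widen_cond (maxn m n)) ?leq_maxl//.
rewrite big_mkcond [leqRHS]big_mkcond leq_sum// => i _.
by case: andP => // -[/Pn->].
Qed.

(** Each exponent occurs three times in a row, the last one possibly less often; the added 3 avoids
    a subtraction. *)
Lemma sum_exp2_divn3 (n : nat) :
  \sum_(j < n) 2 ^ (j %/ 3) + 3 = (3 + n %% 3) * 2 ^ (n %/ 3).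
Proof.
elim: n => [|n IHn]; first by rewrite big_ord0.
rewrite big_ord_recr/= addnAC IHn -mulSnr.
have [n2|n2] := eqVneq (n %% 3) 2.
  have -> : n.+1 %% 3 = 0 by lia.
  have -> : n.+1 %/ 3 = (n %/ 3).+1 by lia.
  by rewrite n2 expnS; lia.
have -> : n.+1 %% 3 = (n %% 3).+1 by lia.
by have -> : n.+1 %/ 3 = n %/ 3 by lia.
Qed.

(* The constants 4, 5, 7 solve the linear inequalities that the induction step
   from n - 7 to n requires in the three residue classes modulo 3. *)
Lemma sum_sum_exp2_divn3 (m n : nat) :
  \sum_(c < m) \sum_(j < n - 7 * c) 2 ^ (j %/ 3) <=
    nth 0 [:: 4; 5; 7] (n %% 3) * 2 ^ (n %/ 3).
Proof.
elim: m n => [|m IHm] n; first by rewrite big_ord0.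
rewrite big_ord_recl muln0 subn0.
rewrite (eq_bigr (fun c : 'I_m => \sum_(j < n - 7 - 7 * c) 2 ^ (j %/ 3))); last first.
  by move=> c _; rewrite /= /bump/= add1n mulnS subnDA.
have := sum_exp2_divn3 n; set K := \sum_(j < n) _ => HK.
have := IHm (n - 7); set T := \sum_(c < m) _ => HT.
have [n7|n7] := ltnP n 7.
  (* Here the induction hypothesis only gives [T <= 4], which is enough for each [n] from 0 to 6. *)
  have n70 : n - 7 = 0 by lia.
  move: HT HK; rewrite n70 div0n mod0n /= => HT.
  have := divn_eq n 3; have : n %% 3 < 3 by rewrite ltn_mod.
  move: (n %/ 3) (n %% 3) => q r r3 nqr; have q3 : q < 3 by lia.
  by case: q q3 nqr => [|[|[|]]]//; case: r r3 => [|[|[|]]]//= *; lia.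
have e2 k : 2 ^ k.+1 = 2 * 2 ^ k by rewrite expnS.
(* The offsets are chosen so that [(n - 7) %/ 3] is [a] in all three cases. *)
have [a [|[]]] : exists a, n = 3 * a + 9 \/ (n = 3 * a + 7 \/ n = 3 * a + 8).
  have : n %% 3 < 3 by rewrite ltn_mod.
  move=> ?; case: (eqVneq (n %% 3) 0) => ?;
    [exists (n %/ 3 - 3)|exists (n %/ 3 - 2)]; lia.
- move=> na; move: HT HK.
  have -> : n %% 3 = 0 by lia.
  have -> : (n - 7) %% 3 = 2 by lia.
  have -> : n %/ 3 = a.+3 by lia.
  have -> : (n - 7) %/ 3 = a by lia.
  by rewrite /= !e2; lia.
- move=> na; move: HT HK.
  have -> : n %% 3 = 1 by lia.
  have -> : (n - 7) %% 3 = 0 by lia.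
  have -> : n %/ 3 = a.+2 by lia.
  have -> : (n - 7) %/ 3 = a by lia.
  by rewrite /= !e2; lia.
- move=> na; move: HT HK.
  have -> : n %% 3 = 2 by lia.
  have -> : (n - 7) %% 3 = 1 by lia.
  have -> : n %/ 3 = a.+2 by lia.
  have -> : (n - 7) %/ 3 = a by lia.
  by rewrite /= !e2; lia.
Qed.

(* The condition under which s may spoil a walk when i < s <= j; the case
   j < s <= i is its mirror image. *)
Definition left_defect (D i j s : nat) : bool :=
  (i < s) && (4 * D + 3 * s <= 3 + 3 * i + 7 * j).

(** With [c = D - i - j - 1] the defect inequality reads [3 s <= 3 D - 4 i - 7 c - 4]. The geometric
    series over [s] is thus below [g i c], and summing over [i] for fixed [c] leads to the double
    sum above with [n = 3 D]. *)
Lemma sum_left_defect (D : nat) :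
  \sum_(i < D) \sum_(j < D | i + j < D) \sum_(s < D | left_defect D i j s)
     2 ^ (i + s) <= 4 * 2 ^ D.
Proof.
(* [P i c] says that [s = 0] satisfies the inequality; otherwise no [s] does. *)
pose P i c := 4 * i + 7 * c + 4 <= 3 * D.
pose g i c := 2 ^ ((3 * D - 7 * c - i.+1) %/ 3).
apply: (@leq_trans (\sum_(i < D) \sum_(c < D | P i c) g i c)).
  apply: leq_sum => i _.
  apply: (@leq_trans (\sum_(j < D | i + j < D)
      if P i (D - i - j.+1) then g i (D - i - j.+1) else 0)).
    apply: leq_sum => j ijD; case: ifPn => [Pij|nPij]; last first.
      by rewrite big1// => s /andP[]; move: nPij; rewrite /P; lia.
    set c := D - i - j.+1 in Pij *.
    apply: (@leq_trans (\sum_(s < ((3 * D - 4 * i - 7 * c - 4) %/ 3).+1) 2 ^ (i + s))).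
      apply: (leq_sum_ord_cond _ _ (left_defect D i j) (fun s => 2 ^ (i + s))).
      by move=> s /andP[ltis ?]; rewrite /c in Pij *; lia.
    under eq_bigr => s _ do rewrite expnD.
    rewrite -big_distrr /= /g; set m := (_ %/ 3).+1.
    have -> : (3 * D - 7 * c - i.+1) %/ 3 = i + m by rewrite /P in Pij; lia.
    by rewrite expnD leq_mul2l -[leqRHS]sum_exp2 leqnSn orbT.
  have iD := ltn_ord i.
  rewrite (eq_bigl (fun j : 'I_D => j < D - i)); last by move=> j; rewrite ltn_subRL.
  rewrite -(big_ord_widen _ (fun j => if P i (D - i - j.+1) then
     g i (D - i - j.+1) else 0)) ?leq_subr//.
  rewrite -(big_mkord xpredT (fun j => if P i (D - i - j.+1) then
     g i (D - i - j.+1) else 0)) big_nat_rev/= big_nat.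
  rewrite (eq_bigr (fun c => if P i c then g i c else 0)); last first.
    by move=> c /andP[_ cD]; have -> : D - i - (0 + (D - i) - c.+1).+1 = c by lia.
  rewrite -big_nat big_mkord [leqRHS]big_mkcond /=.
  rewrite (big_ord_widen D (fun c => if P i c then g i c else 0)) ?leq_subr//.
  by rewrite big_mkcond /= leq_sum// => c _; case: ifP.
rewrite (exchange_big_dep xpredT)//=.
apply: leq_trans (leq_trans (sum_sum_exp2_divn3 D (3 * D)) _); last first.
  by rewrite modnMr mulKn.
apply: leq_sum => c _.
rewrite -[leqRHS](big_mkord xpredT (fun j => 2 ^ (j %/ 3))) big_nat_rev/= big_mkord.
apply: (leq_sum_ord_cond _ _ (P^~ c) (g^~ c)) => i.
by rewrite /P; lia.
Qed.

(** * Words and their extensions *)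

(** A period [p] would give a border of length [size w - p]. *)
Lemma unbordered_aperiodic (T : eqType) (x0 : T) (w : seq T) (p : nat) :
  unbordered w -> 0 < p < size w ->
  ~ (forall k, k + p < size w -> nth x0 w k = nth x0 w (k + p)).
Proof.
move=> unb /andP[p0 pw] per; apply: (unb (size w - p)); [lia|lia|].
have sz : size (take (size w - p) w) = size w - p by rewrite size_take_min; lia.
apply: (@eq_from_nth _ x0); first by rewrite sz size_drop; lia.
rewrite sz => k kw; rewrite nth_take// nth_drop per; last lia.
by congr nth; lia.
Qed.

Lemma plus_power_free_period (T : eqType) (x0 : T) (w : seq T) (a p n : nat) :
  plus_power_free (7%:R / 4%:R)%R w -> 0 < p -> a + n <= size w ->
  (forall k, k + p < n -> nth x0 w (a + k) = nth x0 w (a + k + p)) ->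
  4 * n <= 7 * p.
Proof.
move=> free p0 anw per; case: leqP => // lt74.
have pn : p <= n by lia.
(* Cutting the factor to length at most [2 p] makes it a word [x] followed by a prefix of [x], so
   [k = 1] suffices; its exponent still exceeds 7/4 because 2 does. *)
pose m := minn (n - p) p.
have mp : m <= p by rewrite /m; lia.
have mn : p + m <= n by rewrite /m; lia.
exfalso; apply: free.
have szx : size (take p (drop a w)) = p by rewrite size_take_min size_drop; lia.
have szy : size (take m (drop (a + p) w)) = m by rewrite size_take_min size_drop; lia.
exists (take p (drop a w)), (take m (drop (a + p) w)), 1 => z.
have zE : z = take (p + m) (drop a w).
  by rewrite /z /= cats0 takeD drop_drop addnC.
split=> //.
- by move=> x_nil; rewrite x_nil in szx; rewrite -szx in p0.
- have -> : take m (drop (a + p) w) = take m (take p (drop a w)).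
    apply: (@eq_from_nth _ x0).
      by rewrite szy size_take_min szx; lia.
    rewrite szy => k km; rewrite !nth_take ?nth_drop; [|lia..].
    by rewrite per; [congr nth; lia|rewrite /m in km mn *; lia].
  by rewrite prefix_take.
- by rewrite zE; apply/infixP; exists (take a w), (drop (p + m) (drop a w));
    rewrite cat_take_drop cat_take_drop.
- have -> : size z = p + m by rewrite zE size_take_min size_drop; lia.
  rewrite szx ltr_pdivlMr ?ltr0n// mulrAC ltr_pdivrMr ?ltr0n//.
  by rewrite -!natrM ltr_nat /m; lia.
Qed.

(** * Binary coding of Kautz extensions *)

Definition step (a : 'I_3) (b : bool) : 'I_3 := (if b then a + 1 else a - 1)%R.

Lemma step_neq (a : 'I_3) (b : bool) : a != step a b.
Proof. by case: b; case: a => -[|[|[|]]]. Qed.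

Lemma step_inj (a : 'I_3) : injective (step a).
Proof. by case: a => -[|[|[|]]]// ? [] []. Qed.

(* The extension of a Kautz word ending in the letter a, coded by the
   binary choice made for each new letter. *)
Fixpoint decode (a : 'I_3) (bs : seq bool) : seq 'I_3 :=
  if bs is b :: bs' then step a b :: decode (step a b) bs' else [::].

Lemma size_decode (a : 'I_3) (bs : seq bool) : size (decode a bs) = size bs.
Proof. by elim: bs a => //= b bs IH a; rewrite IH. Qed.

Lemma take_decode (a : 'I_3) (n : nat) (bs : seq bool) :
  take n (decode a bs) = decode a (take n bs).
Proof. by elim: bs a n => [|b bs IH] a [|n] //=; rewrite IH. Qed.

Lemma decode_inj (a : 'I_3) : injective (decode a).
Proof.
move=> bs; elim: bs a => [|b bs IH] a [|b' bs']//= [] /step_inj->.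
by move=> /IH->.
Qed.

Lemma decode_path (a : 'I_3) (bs : seq bool) :
  path (fun x y => x != y) a (decode a bs).
Proof. by elim: bs a => //= b bs IH a; rewrite step_neq IH. Qed.

Lemma decode_nth_take (a : 'I_3) (n : nat) (bs bs' : seq bool) :
  n <= size bs -> n <= size bs' ->
  (forall m, m < n -> nth ord0 (decode a bs) m = nth ord0 (decode a bs') m) ->
  take n bs = take n bs'.
Proof.
move=> nbs nbs' eq_nth; apply: (@decode_inj a); rewrite -!take_decode.
apply: (@eq_from_nth _ ord0).
  by rewrite !size_take_min !size_decode; lia.
rewrite size_take_min size_decode => m mn.
have ltmn : m < n by lia.
by rewrite !nth_take// eq_nth.
Qed.

(* The code l of the letters to the left of w is read from w outwards. *)
Definition extend (w : seq 'I_3) (l r : seq bool) : seq 'I_3 :=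
  rev (decode (head ord0 w) l) ++ w ++ decode (last ord0 w) r.

Lemma size_extend (w : seq 'I_3) (l r : seq bool) :
  size (extend w l r) = size l + size w + size r.
Proof. by rewrite !size_cat size_rev !size_decode addnA. Qed.

Lemma nth_extend_left (w : seq 'I_3) (l r : seq bool) (m : nat) :
  m < size l ->
  nth ord0 (extend w l r) (size l - m.+1) = nth ord0 (decode (head ord0 w) l) m.
Proof.
move=> ml; rewrite nth_cat size_rev size_decode ltn_subrL (leq_ltn_trans _ ml)//=.
rewrite nth_rev size_decode; last by lia.
by congr nth; lia.
Qed.

Lemma nth_extend_mid (w : seq 'I_3) (l r : seq bool) (k : nat) :
  k < size w -> nth ord0 (extend w l r) (size l + k) = nth ord0 w k.
Proof.
move=> kw; rewrite nth_cat size_rev size_decode ltnNge leq_addr/= addKn.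
by rewrite nth_cat kw.
Qed.

Lemma nth_extend_right (w : seq 'I_3) (l r : seq bool) (m : nat) :
  nth ord0 (extend w l r) (size l + size w + m) =
    nth ord0 (decode (last ord0 w) r) m.
Proof.
rewrite nth_cat size_rev size_decode ltnNge -addnA leq_addr/= addKn.
by rewrite nth_cat ltnNge leq_addr/= addKn.
Qed.

Lemma kautz_extend (w : seq 'I_3) (l r : seq bool) :
  0 < size w -> kautz_word w -> kautz_word (extend w l r).
Proof.
case: w => // a w _; rewrite /extend /kautz_word /= => aw.
(* The word splits at the first letter of [w]; since [!=] is symmetric, the left part may be read
   outwards. *)
have revE (x : seq 'I_3) (b : 'I_3) s : sorted (fun y z => y != z) (rev s ++ b :: x) =
    path (fun y z => y != z) b s && path (fun y z => y != z) b x.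
  elim: s b x => //= c s IH b x.
  by rewrite rev_cons cat_rcons IH /= andbCA andbA [b == c]eq_sym.
by rewrite revE cat_path aw !decode_path.
Qed.

Lemma extend_inj (w : seq 'I_3) (l l' r r' : seq bool) :
  size l = size l' -> extend w l r = extend w l' r' -> l = l' /\ r = r'.
Proof.
move=> szl /eqP; rewrite !eqseq_cat ?size_rev ?size_decode//.
by case/and3P=> /eqP/(can_inj revK)/decode_inj-> _ /eqP/decode_inj->.
Qed.

(** * Geodesics *)

(* A walk of length t is encoded by the word f 0, ..., f (D + t - 1);
   [overlap] says that its end points are also joined by a walk of length s. *)
Definition overlap (D : nat) (f : nat -> 'I_3) (t s : nat) : bool :=
  [forall k : 'I_D, (s <= k) ==> (f k == f (k + (t - s)))].

(** For [t <= D] the range ['I_D] contains every [s < t]. *)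
Definition overlap_free (D : nat) (f : nat -> 'I_3) (t : nat) : bool :=
  [forall s : 'I_D, (s < t) ==> ~~ overlap D f t s].

Lemma overlapP (D : nat) (f : nat -> 'I_3) (t s : nat) :
  reflect (forall k, s <= k -> k < D -> f k = f (k + (t - s))) (overlap D f t s).
Proof.
apply: (iffP forallP) => [h k sk kD|h k].
  by have /implyP/(_ sk)/eqP := h (Ordinal kD).
by apply/implyP => sk; apply/eqP/h.
Qed.

Lemma overlap_freeP (D : nat) (f : nat -> 'I_3) (t : nat) : t <= D ->
  reflect (forall s, s < t -> ~ overlap D f t s) (overlap_free D f t).
Proof.
move=> tD; apply: (iffP forallP) => [h s st|h s].
  by have /implyP/(_ st)/negP := h (Ordinal (leq_trans st tD)).
by apply/implyP => st; apply/negP/h.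
Qed.

Section Geodesics.
Variables (D : nat) (u0 : kautz D).

(** [u0] is the default for letters that do not form a Kautz word. *)
Definition factor (f : nat -> 'I_3) (k : nat) : kautz D :=
  insubd u0 [tuple of map f (iota k D)].

Section Word.
Variables (f : nat -> 'I_3) (n : nat).
Hypothesis f_kautz : forall j, j.+1 < n -> f j != f j.+1.

Lemma kautz_word_map_iota (k m : nat) : k + m <= n -> kautz_word (map f (iota k m)).
Proof.
move=> kmn; apply/(sortedP ord0) => i; rewrite size_map size_iota => im.
by rewrite !(nth_map 0) ?size_iota ?nth_iota ?addnS; try lia; apply: f_kautz; lia.
Qed.

Lemma val_factor (k : nat) : k + D <= n -> factor f k = map f (iota k D) :> seq 'I_3.
Proof. by move=> kn; rewrite [kautz_tuple _]insubdK//; apply: kautz_word_map_iota. Qed.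

Lemma nth_factor (k j : nat) : k + D <= n -> j < D ->
  nth ord0 (factor f k) j = f (k + j).
Proof.
by move=> kn jD; rewrite val_factor// (nth_map 0) ?size_iota// nth_iota.
Qed.

Lemma factor_eq (k : nat) (x : kautz D) : k + D <= n ->
  (forall j, j < D -> nth ord0 x j = f (k + j)) -> factor f k = x.
Proof.
move=> kn xE; apply/val_inj/val_inj/(@eq_from_nth _ ord0) => /=.
  by rewrite !size_tuple.
by rewrite size_tuple => j jD; rewrite nth_factor// xE.
Qed.

Lemma factor_edge (k : nat) : 0 < D -> k + D < n ->
  kautz_edge (factor f k) (factor f k.+1).
Proof.
move=> D0 kn; apply/existsP; exists (f (k + D)).
rewrite !val_factor ?addSn ?(ltnW kn)// -map_rcons.
have iotaS : rcons (iota k D) (k + D) = iota k D.+1 by rewrite -addn1 iotaD cats1.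
rewrite iotaS kautz_word_map_iota ?addnS//=.
case: D D0 iotaS => // d _ iotaS.
rewrite /= -map_rcons.
by have [->] : rcons (iota k d.+1) (k + d.+1) = k :: iota k.+1 d.+1.
Qed.

Lemma factor_path (t : nat) : 0 < D -> D + t <= n ->
  path (@kautz_edge D) (factor f 0) [seq factor f k | k <- iota 1 t].
Proof.
move=> D0 tn; apply/(pathP u0) => i; rewrite size_map size_iota => it.
rewrite -[factor f 0 :: _]/(map (factor f) (iota 0 t.+1)).
rewrite !(nth_map 0) ?size_iota ?nth_iota//; try lia.
by apply: factor_edge => //; lia.
Qed.

End Word.

(** Each edge deletes the first letter. Hence any walk shorter than [t] between the end points
    yields an [overlap]. *)
Lemma walk_shift (x : kautz D) (q : seq (kautz D)) (k : nat) :
  path (@kautz_edge D) x q -> k + size q < D ->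
  nth ord0 (last x q) k = nth ord0 x (k + size q).
Proof.
elim: q x => [|z q IH] x /=; first by rewrite addn0.
case/andP=> /existsP[a /andP[_ /eqP zE]] qz kq.
rewrite IH//; last by lia.
rewrite zE nth_rcons size_behead size_tuple nth_behead addnS.
by rewrite (_ : _ < _); last lia.
Qed.

Lemma factor_geodesic (f : nat -> 'I_3) (t : nat) :
  0 < D -> t <= D -> (forall j, j.+1 < D + t -> f j != f j.+1) ->
  overlap_free D f t ->
  geodesic (@kautz_edge D) (factor f 0) (factor f t)
    [seq factor f k | k <- iota 1 t].
Proof.
move=> D0 tD f_kautz free; split.
- exact: factor_path f_kautz t D0 (leqnn _).
- case: (t) => // m.
  by rewrite (last_nth u0) /= size_map size_iota /=
     -[factor f 1 :: _]/(map _ (iota 1 m.+1)) (nth_map 0) ?size_iota// nth_iota.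
move=> q qpath qlast; rewrite size_map size_iota leqNgt; apply/negP => qt.
apply: (overlap_freeP _ _ _ tD free _ qt); apply/overlapP => k qk kD.
have := walk_shift _ _ (k - size q) qpath; rewrite qlast subnK// => /(_ kD).
rewrite !(nth_factor _ _ f_kautz); try lia.
by move=> <-; congr f; lia.
Qed.

End Geodesics.

(** * Counting the extensions with a shortcut *)

Section Extensions.
Variables (D : nat) (w : seq 'I_3).
Hypothesis size_w : size w = D.+1.

Definition letter (l r : seq bool) : nat -> 'I_3 := nth ord0 (extend w l r).

Lemma letter_mid (l r : seq bool) (k : nat) :
  k <= D -> letter l r (size l + k) = nth ord0 w k.
Proof. by move=> kD; rewrite /letter nth_extend_mid// size_w. Qed.

Lemma letter_kautz (l r : seq bool) (j : nat) : kautz_word w ->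
  j.+1 < D + (size l + size r).+1 -> letter l r j != letter l r j.+1.
Proof.
move=> w_kautz jN; have w0 : 0 < size w by rewrite size_w.
have /(sortedP ord0) := kautz_extend w l r w0 w_kautz.
by apply; rewrite size_extend size_w; lia.
Qed.

(** The overlap gives period [i + j + 1 - s] to the positions [s] to [D + i + j - s], while [w]
    occupies [i] to [i + D]. The truncated differences [s - i] and [s - j] count the letters of [w]
    outside that range at its two ends. *)
Lemma overlap_period (l r : seq bool) (s k : nat) :
  let i := size l in let j := size r in
  overlap D (letter l r) (i + j).+1 s -> s <= i + j < D ->
  s - i <= k -> k + ((i + j).+1 - s) < D.+1 - (s - j) ->
  nth ord0 w k = nth ord0 w (k + ((i + j).+1 - s)).
Proof.
move=> i j /overlapP per /andP[sij ijD] sk kD.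
rewrite -!(letter_mid l r); try lia.
by rewrite -/i addnA; apply: per; lia.
Qed.

Lemma overlap_defect (l r : seq bool) (s : nat) :
  let i := size l in let j := size r in
  unbordered w -> plus_power_free (7%:R / 4%:R)%R w ->
  s <= i + j < D -> overlap D (letter l r) (i + j).+1 s ->
  left_defect D i j s || left_defect D j i s.
Proof.
move=> i j unb free sijD ov.
have per := overlap_period l r s _ ov sijD; rewrite -/i -/j in per.
have p0 : 0 < (i + j).+1 - s by lia.
have le74 : 4 * (D.+1 - (s - i) - (s - j)) <= 7 * ((i + j).+1 - s).
  apply: (plus_power_free_period _ ord0 _ (s - i) _ _ free p0).
    by rewrite size_w; lia.
  by move=> k kn; apply: per; lia.
case/andP: sijD => sij ijD; have [si|si] := leqP s i; have [sj|sj] := leqP s j.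
(* All of [w] lies in the periodic range, and the period is at most [D]. *)
- exfalso; apply: (unbordered_aperiodic _ ord0 _ ((i + j).+1 - s) unb).
    by rewrite size_w; lia.
  by move=> k; rewrite size_w => kD; apply: per; lia.
- by apply/orP; right; rewrite /left_defect sj; clear per; lia.
- by apply/orP; left; rewrite /left_defect si; clear per; lia.
(* Now [le74] reads [4 D <= 3 (i + j) + 3 + s], impossible for [s <= i + j < D]. *)
- by exfalso; clear per; lia.
Qed.

(** The period shifts position [i - m - 1], left of [w], to a position inside [w]. *)
Lemma overlap_left (l r : seq bool) (s m : nat) :
  let i := size l in let j := size r in
  s <= i + j < D -> overlap D (letter l r) (i + j).+1 s -> m < i - s ->
  nth ord0 (decode (head ord0 w) l) m = nth ord0 w (i + j - m - s).
Proof.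
move=> i j sijD /overlapP ov mi.
rewrite -(nth_extend_left w l r); last by lia.
rewrite -(letter_mid l r); last by lia.
by rewrite -/(letter l r) ov; [congr letter; lia|lia..].
Qed.

Lemma overlap_right (l r : seq bool) (s m : nat) :
  let i := size l in let j := size r in
  s <= i + j < D -> overlap D (letter l r) (i + j).+1 s -> m < j - s ->
  nth ord0 (decode (last ord0 w) r) m = nth ord0 w (D + m + s - j - i).
Proof.
move=> i j sijD /overlapP ov mj.
rewrite -(nth_extend_right w l r) size_w -(letter_mid l r); last by lia.
by rewrite -/(letter l r) [RHS]ov; [congr letter; lia|lia..].
Qed.

Lemma overlap_take (l l' r r' : seq bool) (s : nat) :
  size l = size l' -> size r = size r' ->
  let i := size l in let j := size r in s <= i + j < D ->
  overlap D (letter l r) (i + j).+1 s -> overlap D (letter l' r') (i + j).+1 s ->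
  take (i - s) l = take (i - s) l' /\ take (j - s) r = take (j - s) r'.
Proof.
move=> szl szr i j; rewrite /i /j => sijD ov ov'.
have sijD' := sijD; have ov2 := ov'; rewrite szl szr in sijD' ov2.
split.
  apply: (@decode_nth_take (head ord0 w)); rewrite ?szl ?leq_subr// -?szl => m mi.
  rewrite (overlap_left _ _ _ _ sijD ov) //.
  by rewrite (overlap_left _ _ _ _ sijD' ov2) -?szl ?szr.
apply: (@decode_nth_take (last ord0 w)); rewrite ?szr ?leq_subr// -?szr => m mi.
rewrite (overlap_right _ _ _ _ sijD ov) //.
by rewrite (overlap_right _ _ _ _ sijD' ov2) -?szr ?szl.
Qed.

(** End points determine the extension. If [t] and [t'] differed, the shorter walk would be an
    overlap of the longer one. As [t <= D], the end points cover the whole word, and [w] can occur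
    in it only once. *)
Lemma overlap_free_inj (l l' r r' : seq bool) :
  let t := (size l + size r).+1 in let t' := (size l' + size r').+1 in
  unbordered w -> t <= D -> t' <= D ->
  overlap_free D (letter l r) t -> overlap_free D (letter l' r') t' ->
  (forall k, k < D -> letter l r k = letter l' r' k) ->
  (forall k, k < D -> letter l r (t + k) = letter l' r' (t' + k)) ->
  l = l' /\ r = r'.
Proof.
move=> t t' unb tD t'D free free' eq_first eq_last.
have leq_of (f f' : nat -> 'I_3) (m m' : nat) : m' <= D -> overlap_free D f' m' ->
    (forall k, k < D -> f k = f' k) -> (forall k, k < D -> f (m + k) = f' (m' + k)) ->
    m' <= m.
  move=> m'D ff eq1 eq2; rewrite leqNgt; apply/negP => mm'.
  apply: (overlap_freeP _ _ _ m'D ff _ mm'); apply/overlapP => k mk kD.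
  rewrite -eq1// -{1}(subnKC mk) eq2; last by lia.
  by congr f'; lia.
have tt' : t = t'.
  apply/eqP; rewrite eqn_leq (leq_of (letter l r) (letter l' r') t t')// andbT.
  by apply: (leq_of (letter l' r') (letter l r)) => // k kD;
    [rewrite eq_first|rewrite eq_last].
have eq_all k : k < D + t -> letter l r k = letter l' r' k.
  move=> kDt; have [kD|Dk] := ltnP k D; first exact: eq_first.
  by rewrite -(subnKC (leq_trans tD Dk)) eq_last -?tt'//; lia.
(* Two occurrences of [w] at distance [size a' - size a <= D] would make that distance a period of
   [w]. *)
have not_lt (a a' b b' : seq bool) : size a + size b = size a' + size b' ->
    size a + size b < D ->
    (forall k, k < D + (size a + size b).+1 -> letter a b k = letter a' b' k) ->
    size a' <= size a.
  move=> sz abD eq_ab; rewrite leqNgt; apply/negP => aa'.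
  apply: (unbordered_aperiodic _ ord0 _ (size a' - size a) unb).
    by rewrite size_w; lia.
  move=> k; rewrite size_w => kD.
  rewrite -(letter_mid a' b'); last by lia.
  rewrite -eq_ab; last by lia.
  rewrite -(letter_mid a b); last by lia.
  by congr letter; lia.
have [sz] := tt'.
have szl : size l = size l'.
  apply/eqP; rewrite eqn_leq (not_lt l' l r' r) ?(not_lt l l' r r') -?sz//.
  by move=> k kD; rewrite eq_all.
apply: (@extend_inj w) => //; apply: (@eq_from_nth _ ord0).
  by rewrite !size_extend size_w; lia.
by move=> k; rewrite size_extend size_w => kN; apply: eq_all; rewrite /t; lia.
Qed.

(** The [i - s] and [j - s] choices nearest to [w] are forced, so the remaining outer choices,
    [minn i s] and [minn j s] in number, determine the walk. *)
Lemma card_overlap (i j s : nat) : s <= i + j < D ->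
  #|[set lr : i.-tuple bool * j.-tuple bool |
      overlap D (letter lr.1 lr.2) (i + j).+1 s]| <=
    2 ^ (i - (i - s) + (j - (j - s))).
Proof.
move=> sijD.
pose outer (lr : i.-tuple bool * j.-tuple bool) :=
  ([tuple of drop (i - s) lr.1], [tuple of drop (j - s) lr.2]).
rewrite expnD -card_bool -!card_tuple -card_prod.
apply: (@leq_card_in _ _ outer) => -[l r] [l' r']; rewrite !inE /= => ov ov'.
move=> [] eql eqr.
have := overlap_take l l' r r' s.
rewrite /= !size_tuple => /(_ erefl erefl sijD ov ov') [eql' eqr'].
congr pair; apply: val_inj.
  by rewrite /= -[LHS](cat_take_drop (i - s)) eql' eql cat_take_drop.
by rewrite /= -[LHS](cat_take_drop (j - s)) eqr' eqr cat_take_drop.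
Qed.

Lemma card_overlap_defect (i j s : nat) :
  unbordered w -> plus_power_free (7%:R / 4%:R)%R w -> s <= i + j < D ->
  #|[set lr : i.-tuple bool * j.-tuple bool |
      overlap D (letter lr.1 lr.2) (i + j).+1 s]| <=
    (if left_defect D i j s then 2 ^ (i + s) else 0) +
    (if left_defect D j i s then 2 ^ (j + s) else 0).
Proof.
move=> unb free sijD.
(* The defect depends on sizes only, so a single failing walk establishes it. *)
have [->|[[l r]]] := set_0Vmem [set lr : i.-tuple bool * j.-tuple bool |
      overlap D (letter lr.1 lr.2) (i + j).+1 s]; first by rewrite cards0.
rewrite inE /= => ov.
have := overlap_defect l r s unb free; rewrite !size_tuple => /(_ sijD ov) defect.
apply: leq_trans (card_overlap i j s sijD) _.
(* From [i < s] follow [i - (i - s) = i] and [j - (j - s) <= s]. *)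
have [/andP[si _]|nij] := ifPn (left_defect D i j s).
  by apply: leq_trans (leq_addr _ _); rewrite leq_exp2l//; lia.
have ji : left_defect D j i s by rewrite (negPf nij) in defect.
by rewrite ji add0n leq_exp2l//; case/andP: ji; lia.
Qed.

(** Union bound over [s]: each walk outside the set has an overlap for some [s <= i + j]. *)
Lemma card_overlap_free (i j : nat) :
  unbordered w -> plus_power_free (7%:R / 4%:R)%R w -> i + j < D ->
  2 ^ (i + j) <=
  #|[set lr : i.-tuple bool * j.-tuple bool |
      overlap_free D (letter lr.1 lr.2) (i + j).+1]| +
  \sum_(s < D) ((if left_defect D i j s then 2 ^ (i + s) else 0) +
    (if left_defect D j i s then 2 ^ (j + s) else 0)).
Proof.
move=> unb free ijD.
set A := [set _ | _].
have -> : 2 ^ (i + j) = #|A| + #|~: A|.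
  by rewrite cardsC card_prod !card_tuple card_bool expnD.
rewrite leq_add2l -sum1_card.
pose B s (lr : i.-tuple bool * j.-tuple bool) :=
  overlap D (letter lr.1 lr.2) (i + j).+1 s.
apply: (@leq_trans (\sum_(s < D | s < (i + j).+1) #|[set lr | B s lr]|)); last first.
  rewrite big_mkcond leq_sum// => s _; case: ifPn => // sij.
  by apply: card_overlap_defect => //; rewrite -ltnS sij.
apply: (@leq_trans (\sum_(lr in ~: A) \sum_(s < D | s < (i + j).+1) B s lr)).
  apply: leq_sum => lr; rewrite !inE negb_forall => /existsP[s].
  rewrite negb_imply negbK => /andP[sij ov].
  by rewrite (bigD1 s)//= /B ov.
rewrite exchange_big /= leq_sum// => s _.
rewrite -sum1_card big_mkcond [leqRHS]big_mkcond leq_sum// => lr _.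
by rewrite inE; case: ifP => // _; case: (B s lr).
Qed.

End Extensions.

Lemma sum_defects (D : nat) :
  \sum_(i < D) \sum_(j < D | i + j < D) \sum_(s < D)
     ((if left_defect D i j s then 2 ^ (i + s) else 0) +
      (if left_defect D j i s then 2 ^ (j + s) else 0)) <= 8 * 2 ^ D.
Proof.
under eq_bigr => i _ do under eq_bigr => j _ do rewrite big_split -!big_mkcond /=.
under eq_bigr => i _ do rewrite big_split.
rewrite big_split /=.
rewrite [X in _ + X](exchange_big_dep xpredT)//=.
under [X in _ + X]eq_bigr => j _ do under eq_bigl => i do rewrite addnC.
by rewrite addnn -mul2n -[8]/(2 * 4) -mulnA leq_mul2l sum_left_defect.
Qed.

(** * From extensions to the congestion of the edge *)

Lemma edge_word_facts (D : nat) (u v : kautz D) : 0 < D -> kautz_edge u v ->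
  [/\ kautz_word (edge_word u v),
      forall k, k < D -> nth ord0 u k = nth ord0 (edge_word u v) k
    & forall k, k < D -> nth ord0 v k = nth ord0 (edge_word u v) k.+1].
Proof.
move=> D0 /existsP[a /andP[ua /eqP vE]].
have va : last ord0 v = a by rewrite vE last_rcons.
rewrite /edge_word va; split=> // k kD.
  by rewrite nth_rcons size_tuple kD.
rewrite vE !nth_rcons size_behead size_tuple nth_behead.
have -> : (k < D.-1) = (k.+1 < D) by lia.
have -> : (k == D.-1) = (k.+1 == D) by lia.
by [].
Qed.

Lemma letter_pair_cong (D : nat) (u v : kautz D) (l r : seq bool) :
  let f := letter (edge_word u v) l r in let t := (size l + size r).+1 in
  0 < D -> kautz_edge u v -> t <= D -> overlap_free D f t ->
  (factor D u f 0 != factor D u f t) &&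
  `[< exists2 p, geodesic (@kautz_edge D) (factor D u f 0) (factor D u f t) p &
        uses_edge u v (factor D u f 0) p >].
Proof.
move=> f t D0 huv tD free.
have [w_kautz nth_u nth_v] := edge_word_facts _ _ _ D0 huv.
have sz_w : size (edge_word u v) = D.+1 by rewrite size_rcons size_tuple.
have f_kautz j : j.+1 < D + t -> f j != f j.+1 by exact: letter_kautz.
apply/andP; split.
  (* Equal end points would be an overlap with [s = 0]. *)
  apply/eqP => eq0t; apply: (overlap_freeP _ _ _ tD free 0) => //.
  apply/overlapP => k _ kD; rewrite subn0 addnC.
  by rewrite -(nth_factor _ u _ _ f_kautz) -?eq0t ?(nth_factor _ u _ _ f_kautz)//; lia.
apply/asboolP; exists [seq factor D u f k | k <- iota 1 t].
  exact: factor_geodesic.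
rewrite /uses_edge; set x := factor D u f 0; set p := map _ _.
have szp : size (zip (x :: p) p) = t by rewrite size_zip /= size_map size_iota; lia.
have lt_t : size l < size (zip (x :: p) p) by rewrite szp; lia.
(* [w] starts at position [size l], so the walk takes the edge after [size l] steps. *)
suff <- : nth (u, u) (zip (x :: p) p) (size l) = (u, v) by exact: mem_nth.
rewrite szp in lt_t.
rewrite nth_zip_cond szp lt_t /=.
rewrite /x -[_ :: _]/(map (factor D u f) (iota 0 t.+1)).
rewrite !(nth_map 0) ?size_iota ?nth_iota//; try lia.
congr pair; apply: (factor_eq _ _ _ _ f_kautz); try lia.
  by move=> j jD; rewrite nth_u// add0n /f (letter_mid D)//; lia.
by move=> j jD; rewrite nth_v// add1n addSn -addnS /f (letter_mid D).
Qed.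

Theorem corollary6p6 (D : nat) (hD : 35 <= D) (u v : kautz D)
  (huv : kautz_edge u v)
  (hunb : unbordered (edge_word u v))
  (hfree : plus_power_free (7%:R / 4%:R)%R (edge_word u v)) :
  tau2 D < cong (@kautz_edge D) u v.
Proof.
have D0 : 0 < D by lia.
have sz_w : size (edge_word u v) = D.+1 by rewrite size_rcons size_tuple.
have [w_kautz _ _] := edge_word_facts _ _ _ D0 huv.
set w := edge_word u v in hunb hfree sz_w w_kautz.
pose F i j (lr : i.-tuple bool * j.-tuple bool) :=
  (factor D u (letter w lr.1 lr.2) 0, factor D u (letter w lr.1 lr.2) (i + j).+1).
pose good i j := [set lr : i.-tuple bool * j.-tuple bool |
  overlap_free D (letter w lr.1 lr.2) (i + j).+1].
(* The codes are compared as sequences because the tuple types depend on [i] and [j]; equal sizes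
   are part of the conclusion and give the disjointness of the images. *)
have F_inj i j i' j' lr lr' : i + j < D -> i' + j' < D ->
    lr \in good i j -> lr' \in good i' j' -> F i j lr = F i' j' lr' ->
    lr.1 = lr'.1 :> seq bool /\ lr.2 = lr'.2 :> seq bool.
  case: lr lr' => [l r] [l' r'] ijD i'j'D; rewrite !inE /= => free free' [].
  set f := letter w l r in free *; set f' := letter w l' r' in free' * => eq0 eqt.
  have f_kautz k : k.+1 < D + (i + j).+1 -> f k != f k.+1.
    by move=> ?; apply: (letter_kautz D) => //; rewrite !size_tuple.
  have f_kautz' k : k.+1 < D + (i' + j').+1 -> f' k != f' k.+1.
    by move=> ?; apply: (letter_kautz D) => //; rewrite !size_tuple.
  apply: (overlap_free_inj D w sz_w) => //; rewrite ?size_tuple// => k kD.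
    have := congr1 (fun x : kautz D => nth ord0 x k) eq0.
    by rewrite /= (nth_factor _ _ _ _ f_kautz)
         ?(nth_factor _ _ _ _ f_kautz') ?add0n//; lia.
  have := congr1 (fun x : kautz D => nth ord0 x k) eqt.
  by rewrite /= (nth_factor _ _ _ _ f_kautz) ?(nth_factor _ _ _ _ f_kautz')//; lia.
pose A (ij : 'I_D * 'I_D) :=
  if ij.1 + ij.2 < D then F ij.1 ij.2 @: good ij.1 ij.2 else set0.
have A_disj ij ij' : ij != ij' -> [disjoint A ij & A ij'].
  move=> neq; rewrite -setI_eq0; apply/eqP/setP => xy; rewrite !inE; apply/negP.
  rewrite /A; case: ifPn => ijD; last by rewrite inE.
  case: ifPn => ijD'; last by rewrite inE andbF.
  case/andP=> /imsetP[lr lrA ->] /imsetP[lr' lrA' /F_inj[]//].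
  move=> /(congr1 size) + /(congr1 size); rewrite !size_tuple => eq1 eq2.
  move: neq; rewrite (surjective_pairing ij) (surjective_pairing ij') xpair_eqE.
  by rewrite -!val_eqE /= eq1 eq2 !eqxx.
have leq_cong : \sum_(i < D) \sum_(j < D | i + j < D) #|good i j| <=
    cong (@kautz_edge D) u v.
  apply: (@leq_trans #|\bigcup_ij A ij|); last first.
    apply: subset_leq_card; apply/subsetP => xy /bigcupP[ij _].
    rewrite /A; case: ifPn => ijD; last by rewrite in_set0.
    case/imsetP=> -[l r] + ->; rewrite !inE /= => free.
    by have := letter_pair_cong D u v l r D0 huv; rewrite /= !size_tuple => /(_ ijD free).
  rewrite -sum1_card partition_disjoint_bigcup//=.
  rewrite -(pair_big xpredT xpredT (fun i j => \sum_(x in A (i, j)) 1)) /=.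
  apply: leq_sum => i _; rewrite big_mkcond leq_sum// => j _.
  rewrite sum1_card /A /=; case: ifPn => // ijD; rewrite card_in_imset//.
  move=> [l r] [l' r'] lrA lrA' /F_inj[]//= ll' rr'.
  by congr pair; apply: val_inj.
have total : \sum_(i < D) \sum_(j < D | i + j < D) 2 ^ (i + j) <=
    cong (@kautz_edge D) u v + 8 * 2 ^ D.
  apply: leq_trans (leq_add leq_cong (sum_defects D)).
  rewrite -big_split leq_sum// => i _; rewrite -big_split leq_sum// => j ijD.
  exact: card_overlap_free.
(* With [X = 2 ^ (D - 2)] the congestion is at least [(4 D - 36) X + 1], and [tau2 D] is
   [(3 D - 1) X]; the hypothesis [35 <= D] is exactly [3 D - 1 <= 4 D - 36]. *)
move: total (sum_exp2_triangle D); rewrite /tau2.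
have -> : 2 ^ D = 4 * 2 ^ (D - 2) by rewrite -(expnD 2 2); congr (2 ^ _); lia.
have -> : 2 ^ (D - 1) = 2 * 2 ^ (D - 2) by rewrite -expnS; congr (2 ^ _); lia.
have : 0 < 2 ^ (D - 2) by rewrite expn_gt0.
nia.
Qed.
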